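(* Let $\mathcal F$ be an algebraic language with no nullary symbols, $\mathbf I=([m];\mathcal F)$ a finite $\mathcal F$-algebra, $\mathbf A$ an $\mathcal F$-algebra with a surjective homomorphism $\chi\colon\mathbf A\to\mathbf I$, $\mathbf C:=\mathfrak C(\mathbf A,\chi)$ and $\alpha:=\ker\chi$. Then for every integer $k\ge2$ and all congruences $\beta_1,\dots,\beta_k$ of $\mathbf A$ with $\beta_j\le\alpha$, \[ [\beta_1,\dots,\beta_k]^*=[\beta_1^*,\dots,\beta_k^*]. \]
   Context: Notation: $[m]=\{1,\dots,m\}$, $m\ge1$; $D^{(i)}:=\chi^{-1}(i)$. The algebra $\mathfrak C(\mathbf A,\chi)$ has universe $C=D^{(1)}\times\dots\times D^{(m)}$ (elements are columns $\mathbf c=(c^{(1)},\dots,c^{(m)})$) and language consisting of an $m$-ary symbol $d$ and, for each $k$-ary $f\in\mathcal F$ and $\mathbf i=(i_1,\dots,i_k)\in[m]^k$, a $k$-ary symbol $\hat f_{\mathbf i}$, interpreted by $d(\mathbf c_1,\dots,\mathbf c_m)=(c_1^{(1)},c_2^{(2)},\dots,c_m^{(m)})$ and: $\hat f_{\mathbf i}(\mathbf c_1,\dots,\mathbf c_k)$ is obtained from $\mathbf c_1$ by replacing its $f^{\mathbf I}(i_1,\dots,i_k)$-th entry by $f^{\mathbf A}(c_1^{(i_1)},\dots,c_k^{(i_k)})$. For a congruence $\beta\le\alpha$ of $\mathbf A$, $\beta^*:=\{(\mathbf a,\mathbf b)\in C^2:(a^{(i)},b^{(i)})\in\beta\ \forall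 i\in[m]\}$, a congruence of $\mathbf C$. Higher commutator: for congruences $\beta_1,\dots,\beta_k$ of an algebra $\mathbf B$, let $M(\beta_1,\dots,\beta_k)\le\mathbf B^{\{0,1\}^k}$ be generated by all maps $g$ such that for some $j\in[k]$ and $a_0\,\beta_j\,a_1$, $g(\epsilon)=a_{\epsilon_j}$ for all $\epsilon\in\{0,1\}^k$. Then $[\beta_1,\dots,\beta_k]$ is the least congruence $\gamma$ such that for all $f\in M(\beta_1,\dots,\beta_k)$, if $f(\epsilon0)\,\gamma\,f(\epsilon1)$ for all $\epsilon\in\{0,1\}^{k-1}\setminus\{1\dots1\}$ then $f(1\dots10)\,\gamma\,f(1\dots11)$. *)

(* Defs.v *)
(* Operations, columns and families are plain functions, so
   functional extensionality is assumed whenever they are compared with [=]. *)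
From Stdlib Require Import RelationClasses FunctionalExtensionality.
From mathcomp Require Import all_boot.
Set Implicit Arguments.
Unset Strict Implicit.
Unset Printing Implicit Defensive.

Record language := Language {
  symbol :> Type;
  arity : symbol -> nat }.

Definition no_nullary (F : language) := forall f : F, 0 < arity f.

Record algebra (F : language) := Algebra {
  carrier :> Type;
  op : forall f : F, ('I_(arity f) -> carrier) -> carrier }.

Arguments Algebra {F} carrier op.
Arguments op {F} a f _.

Definition homomorphism (F : language) (A B : algebra F) (h : A -> B) :=
  forall (f : F) (a : 'I_(arity f) -> A),
    h (op A f a) = op B f (fun l => h (a l)).

Definition surjective (T U : Type) (h : T -> U) := forall u, exists t, h t = u.

Definition kernel (T U : Type) (h : T -> U) (a b : T) : Prop := h a = h b.

Definition congruence (F : language) (B : algebra F) (R : B -> B -> Prop) :=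
  Equivalence R /\
  forall (f : F) (a b : 'I_(arity f) -> B),
    (forall l, R (a l) (b l)) -> R (op B f a) (op B f b).

Section HigherCommutator.
Variables (F : language) (B : algebra F) (k : nat).

Definition cube (n : nat) := {ffun 'I_n -> bool}.

Definition ones (n : nat) : cube n := [ffun=> true].

(* The vertex "e b": for 0 < k, [insub] fails exactly on the last coordinate
   k.-1 of 'I_k. *)
Definition append (e : cube k.-1) (b : bool) : cube k :=
  [ffun i : 'I_k => if insub (val i) is Some j then e j else b].

Variable beta : 'I_k -> B -> B -> Prop.

(* The subalgebra of B^{0,1}^k generated by the beta-cubes. *)
Inductive cube_alg : (cube k -> B) -> Prop :=
| cube_alg_gen (j : 'I_k) (a0 a1 : B) :
    beta j a0 a1 -> cube_alg (fun e => if e j then a1 else a0)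
| cube_alg_op (f : F) (g : 'I_(arity f) -> cube k -> B) :
    (forall l, cube_alg (g l)) -> cube_alg (fun e => op B f (fun l => g l e)).

Definition centralizes (gamma : B -> B -> Prop) :=
  forall f : cube k -> B, cube_alg f ->
    (forall e : cube k.-1, e != ones k.-1 ->
      gamma (f (append e false)) (f (append e true))) ->
    gamma (f (append (ones k.-1) false)) (f (append (ones k.-1) true)).

Definition commutator (x y : B) : Prop :=
  forall gamma, congruence gamma -> centralizes gamma -> gamma x y.

(* The intersection above is the least centralizing congruence, as the three
   lemmas confirm. *)
Lemma commutator_congruence : congruence commutator.
Proof.
split.
- split.
  + by move=> x g [[r _ _] _] _; apply: r.
  + by move=> x y xy g cg zg; case: (cg) => [[_ s _] _]; apply: s; apply: xy.
  + move=> x y z xy yz g cg zg; case: (cg) => [[_ _ t] _].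
    by apply: (t _ y); [apply: xy | apply: yz].
- by move=> f a b ab g cg zg; case: (cg) => _ c; apply: c => l; apply: ab.
Qed.

Lemma commutator_centralizes : centralizes commutator.
Proof. by move=> f Mf H g cg zg; apply: (zg f Mf) => e e1; apply: (H e e1). Qed.

Lemma commutator_least (gamma : B -> B -> Prop) :
  congruence gamma -> centralizes gamma ->
  forall x y, commutator x y -> gamma x y.
Proof. by move=> cg zg x y; apply. Qed.

End HigherCommutator.

Section ColumnAlgebra.
Variables (F : language) (F_pos : no_nullary F) (m : nat).
Variables (I : forall f : F, ('I_(arity f) -> 'I_m) -> 'I_m).
Variables (A : algebra F) (chi : A -> 'I_m).
Hypothesis chi_hom : homomorphism (B := Algebra 'I_m I) chi.

Record column := Column {
  entry :> 'I_m -> A;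
  entryP : forall i, chi (entry i) = i }.

Inductive col_symbol :=
| sym_d
| sym_hat (f : F) (i : 'I_(arity f) -> 'I_m).

Definition col_language : language :=
  @Language col_symbol (fun s =>
    match s with sym_d => m | @sym_hat f _ => arity f end).

Definition op_d (c : 'I_m -> column) : column :=
  Column (fun i => entryP (c i) i).

Definition hat_entry (f : F) (i : 'I_(arity f) -> 'I_m)
    (c : 'I_(arity f) -> column) (j : 'I_m) : A :=
  if j == I i then op A f (fun l => c l (i l))
  else c (Ordinal (F_pos f)) j.

Lemma hat_entryP (f : F) (i : 'I_(arity f) -> 'I_m)
    (c : 'I_(arity f) -> column) (j : 'I_m) :
  chi (hat_entry i c j) = j.
Proof.
rewrite /hat_entry; case: eqP => [->|_]; last exact: entryP.
rewrite chi_hom /=; congr (I _).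
by apply: functional_extensionality => l;
   rewrite entryP.
Qed.

Definition op_hat (f : F) (i : 'I_(arity f) -> 'I_m)
    (c : 'I_(arity f) -> column) : column :=
  Column (hat_entryP i c).

Definition col_algebra : algebra col_language :=
  @Algebra col_language column (fun s =>
    match s return ('I_(@arity col_language s) -> column) -> column with
    | sym_d => op_d
    | @sym_hat f i => @op_hat f i
    end).

Definition star (R : A -> A -> Prop) (a b : col_algebra) : Prop :=
  forall i : 'I_m, R (entry a i) (entry b i).

Lemma star_congruence (R : A -> A -> Prop) :
  congruence R -> congruence (star R).
Proof.
move=> [[r s t] c]; split.
- split; first by move=> a i; apply: r.
  + by move=> a b ab i; apply: s; apply: ab.
  + by move=> x y z xy yz i; apply: (t _ (entry y i)); [apply: xy | apply: yz].
- move=> [|f i] a b ab j /=; first exact: ab.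
  by rewrite /hat_entry; case: eqP => _; [apply: c => l|]; apply: ab.
Qed.

End ColumnAlgebra.

Arguments col_algebra {F} F_pos {m I A chi} chi_hom.
Arguments star {F} F_pos {m I A chi} chi_hom R a b.

(* Main.v *)
(** A column of [C] can be altered in the single entry [chi u] to become [u];
    call the result [upd c u].  Up to [d], which replaces the remaining entries
    by those of [c], the map [upd c] commutes with the basic operations.  Since
    [chi] is constant on every cube generated by the [beta j], it therefore
    carries these to cubes generated by the [star (beta j)], whereas every entry
    map goes back.  The second fact makes [star (commutator beta)] centralize
    the [star (beta j)].  By the first, for every congruence [gamma] of [C]
    centralizing the [star (beta j)], the relation "[chi u = chi v] and [upd c u]
    is [gamma]-related to [upd c v] for all [c]" is a congruence of [A]
    centralizing the [beta j], and [d] glues its instances in the single entries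
    together to [gamma]. *)
Require Import Defs.
From Stdlib Require Import FunctionalExtensionality.
From mathcomp Require Import all_boot.
Set Implicit Arguments.
Unset Strict Implicit.
Unset Printing Implicit Defensive.

Lemma cube_alg_const (F : language) (B : algebra F) (k : nat)
  (beta : 'I_k -> B -> B -> Prop) (j : 'I_k) (b : B) :
  beta j b b -> cube_alg beta (fun=> b).
Proof.
move=> bb; have := cube_alg_gen bb; congr cube_alg.
by apply: functional_extensionality => e; case: (e j).
Qed.

Lemma cube_alg_kernel (F : language) (A B : algebra F) (h : A -> B) (k : nat)
  (beta : 'I_k -> A -> A -> Prop) (g : cube k -> A) :
  homomorphism h -> (forall j a b, beta j a b -> kernel h a b) ->
  cube_alg beta g -> forall e e', h (g e) = h (g e').
Proof.
move=> hom_h le_h; elim=> [j a0 a1 /le_h ha|f {}g _ IH] e e'.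
  by case: (e j); case: (e' j).
rewrite !hom_h; congr (op B f _).
by apply: functional_extensionality => l; apply: IH.
Qed.

Section ColumnUpdate.
Variables (F : language) (F_pos : no_nullary F) (m : nat).
Variables (I : forall f : F, ('I_(arity f) -> 'I_m) -> 'I_m).
Variables (A : algebra F) (chi : A -> 'I_m).
Hypothesis chi_hom : homomorphism (B := Algebra 'I_m I) chi.

Notation C := (col_algebra F_pos chi_hom).
Notation star := (star F_pos chi_hom).

(** The proofs [entryP] are equations in ['I_m], which has decidable equality, so they are
    unique. *)
Lemma column_eq (a b : column chi) : entry a =1 entry b -> a = b.
Proof.
case: a b => a Pa [b Pb] /= /functional_extensionality ab.
rewrite -{}ab in Pb *; congr Column.
by apply: functional_extensionality_dep => i; apply: eq_irrelevance.
Qed.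

Lemma upd_subproof (c : column chi) (u : A) (j : 'I_m) :
  chi (if j == chi u then u else entry c j) = j.
Proof. by case: eqP => [->|_]; last exact: entryP. Qed.

Definition upd (c : column chi) (u : A) : C := Column (upd_subproof c u).

Lemma updE (c : column chi) (u : A) (j : 'I_m) :
  entry (upd c u) j = if j == chi u then u else entry c j.
Proof. by []. Qed.

(** At [I i] the hat operation reads entry [i l] of [upd c (a l)], which is [a l] because
    [chi (a l) = i l]. Keeping [i] a parameter lets different tuples [a] share one hat symbol. *)
Lemma upd_op (c : column chi) (f : F) (a : 'I_(arity f) -> A)
    (i : 'I_(arity f) -> 'I_m) :
  (forall l, chi (a l) = i l) ->
  upd c (op A f a) =
  op_d (fun j => if j == I i
                 then op_hat F_pos chi_hom i (fun l => upd c (a l)) else c).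
Proof.
move=> ai; apply: column_eq => j; rewrite updE chi_hom /=.
have -> : (fun l => chi (a l)) = i by apply: functional_extensionality.
case: ifP => //= ji; rewrite /hat_entry ji; congr (op A f _).
by apply: functional_extensionality => l; rewrite updE ai eqxx.
Qed.

Lemma op_d_upd (a b : column chi) :
  op_d (fun j => upd a (entry b j)) = b.
Proof. by apply: column_eq => j; rewrite /= entryP eqxx. Qed.

Variables (k : nat) (beta : 'I_k -> A -> A -> Prop).

Lemma cube_alg_entry (g : cube k -> C) (i : 'I_m) :
  cube_alg (fun j => star (beta j)) g ->
  cube_alg beta (fun e => entry (g e) i).
Proof.
(* The entry [i] stays general, since a hat operation also reads the entries [i' l]. *)
move=> Mg; elim: Mg i => [j a0 a1 aj|[|f i'] {}g _ IH] i.
- have := cube_alg_gen (aj i); congr cube_alg.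
  by apply: functional_extensionality => e; case: (e j).
- exact: IH.
- rewrite /= /hat_entry; case: eqP => _; last exact: IH.
  by apply: cube_alg_op => l; apply: IH.
Qed.

Hypothesis k_pos : 0 < k.
Hypothesis beta_refl : forall j a, beta j a a.
Hypothesis beta_le : forall j a b, beta j a b -> kernel chi a b.

Lemma cube_alg_upd (c : column chi) (g : cube k -> A) :
  cube_alg beta g -> cube_alg (fun j => star (beta j)) (fun e => upd c (g e)).
Proof.
elim=> [j a0 a1 aj|f {}g Mg IH].
  (* As [chi a0 = chi a1], both updates alter the same entry and agree in all others. *)
  have ajc : star (beta j) (upd c a0) (upd c a1).
    move=> i; rewrite !updE (beta_le aj).
    by case: ifP => _; [exact: aj | exact: beta_refl].
  have := cube_alg_gen (beta := fun j => star (beta j)) ajc; congr cube_alg.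
  by apply: functional_extensionality => e; case: (e j).
(* The vertex is arbitrary: [chi] is constant on each [g l], so one hat symbol serves the whole
   cube. *)
pose i l := chi (g l (ones k)).
have gi e l : chi (g l e) = i l.
  exact: (cube_alg_kernel (B := Algebra 'I_m I) chi_hom beta_le (Mg l)).
have -> : (fun e => upd c (op A f (fun l => g l e))) =
    (fun e => op C (@sym_d F m) (fun j => (if j == I i
       then fun e => op C (@sym_hat F m f i) (fun l => upd c (g l e))
       else fun=> c) e)).
  apply: functional_extensionality => e; rewrite (upd_op c (gi e)) /=.
  by congr op_d; apply: functional_extensionality => j; case: ifP.
apply: cube_alg_op => j; case: ifP => _.
  exact: (cube_alg_op (B := C) (f := @sym_hat F m f i)
            (g := fun l e => upd c (g l e))).
by apply: (cube_alg_const (j := Ordinal k_pos)) => l; apply: beta_refl.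
Qed.

Definition entrywise (gamma : C -> C -> Prop) (u v : A) : Prop :=
  chi u = chi v /\ forall c, gamma (upd c u) (upd c v).

Lemma entrywise_congruence (gamma : C -> C -> Prop) :
  congruence gamma -> congruence (entrywise gamma).
Proof.
move=> [[r s t] comp]; split.
  split=> [u|u v [uv guv]|u v w [uv guv] [vw gvw]].
  - by split=> // c; apply: r.
  - by split=> // c; apply: s.
  - by split=> [|c]; [rewrite uv | apply: t (guv c) (gvw c)].
move=> f a b ab; have chiab l : chi (b l) = chi (a l) by case: (ab l).
split=> [|c].
  by rewrite !chi_hom; congr (I _); apply: functional_extensionality => l.
(* Since [chi] agrees on [a] and [b], both sides become the same term in [d] and one hat symbol. *)
rewrite (upd_op c (fun l => erefl (chi (a l)))) (upd_op c chiab).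
apply: (comp (@sym_d F m)) => j; case: ifP => _; last exact: r.
by apply: (comp (@sym_hat F m f _)) => l; case: (ab l).
Qed.

Lemma entrywise_centralizes (gamma : C -> C -> Prop) :
  centralizes (fun j => star (beta j)) gamma ->
  centralizes beta (entrywise gamma).
Proof.
move=> zg f Mf fe; split=> [|c].
  exact: (cube_alg_kernel (B := Algebra 'I_m I) chi_hom beta_le Mf).
by apply: (zg _ (cube_alg_upd c Mf)) => e /fe[_]; apply.
Qed.

Lemma star_entrywise (gamma : C -> C -> Prop) (x y : C) :
  congruence gamma -> star (entrywise gamma) x y -> gamma x y.
Proof.
(* Both columns are rebuilt over the same base [x], so that [xy j] relates the [j]-th arguments of
   [d]. *)
move=> [_ comp] xy; rewrite -(op_d_upd x x) -(op_d_upd x y).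
by apply: (comp (@sym_d F m)) => j; case: (xy j).
Qed.

End ColumnUpdate.

Theorem theorem3p6 (F : language) (F_pos : no_nullary F)
  (m : nat) (m_pos : 1 <= m)
  (I : forall f : F, ('I_(arity f) -> 'I_m) -> 'I_m)
  (A : algebra F) (chi : A -> 'I_m)
  (chi_hom : homomorphism (B := Algebra 'I_m I) chi)
  (chi_surj : surjective chi)
  (k : nat) (k_ge2 : 2 <= k)
  (beta : 'I_k -> A -> A -> Prop)
  (beta_cong : forall j, congruence (beta j))
  (beta_le : forall j a b, beta j a b -> kernel chi a b)
  (x y : col_algebra F_pos chi_hom) :
  star F_pos chi_hom (commutator beta) x y
  <-> commutator (fun j => star F_pos chi_hom (beta j)) x y.
Proof.
split=> [xy gamma cg zg|].
  have beta_refl j a : beta j a a by case: (beta_cong j) => [[r _ _] _].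
  apply: star_entrywise => // i; apply: (xy i).
    exact: entrywise_congruence.
  exact: entrywise_centralizes (ltnW k_ge2) beta_refl beta_le _ zg.
(* For the converse, centrality of [star (commutator beta)] is checked in each entry separately. *)
apply: commutator_least => [|f Mf fe i].
  by apply: star_congruence; apply: commutator_congruence.
apply: (commutator_centralizes (cube_alg_entry i Mf)) => e e1.
exact: fe.
Qed.
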